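(* Let $f<0$ and $\phi<0$ be negative real constants. Let $$K:=\{v\in H^1_0(0,1):\ v(x)\ge \phi \text{ for a.e. } x\in(0,1)\},\qquad J(v):=\frac12\int_0^1 (v'(x))^2\,dx-\int_0^1 f\,v(x)\,dx ,$$ and let $u\in K$ be the solution of the obstacle problem $J(u)=\inf_{v\in K}J(v)$. (1) If $|f|<8|\phi|$, then $u(x)=\frac f2(x-x^2)$ for $x\in[0,1]$, and $J(u)=-\frac{f^2}{24}$. (2) If $|f|\ge 8|\phi|$, then $$u(x)=\begin{cases}-\frac f2x^2-\sqrt{2\phi f}\,x & \text{if } x\in\left[0,\sqrt{\tfrac{2\phi}{f}}\right),\\[1mm] \phi & \text{if } x\in\left[\sqrt{\tfrac{2\phi}{f}},\,1-\sqrt{\tfrac{2\phi}{f}}\right],\\[1mm] -\frac f2(x-1)^2+\sqrt{2\phi f}\,(x-1) & \text{if } x\in\left(1-\sqrt{\tfrac{2\phi}{f}},1\right],\end{cases}$$ and $$J(u)=f\phi\left(\frac43\sqrt{\frac{2\phi}{f}}-1\right).$$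
   Context: $H^1_0(0,1)$ is the usual Sobolev space of $H^1(0,1)$ functions vanishing at $0$ and $1$; its elements are identified with their continuous representatives on $[0,1]$. The minimizer of $J$ over $K$ exists and is unique. *)

(* Defs.v *)
From HB Require Import structures.
From mathcomp Require Import all_boot all_order all_algebra.
From mathcomp Require Import all_classical all_reals all_analysis.

Set Implicit Arguments.
Unset Strict Implicit.
Unset Printing Implicit Defensive.

Import Order.TTheory GRing.Theory Num.Theory.
Import numFieldNormedType.Exports.

Local Open Scope classical_set_scope.
Local Open Scope ring_scope.

(* A function on a set D is represented by any R -> R; its values outside D
   are irrelevant. *)

(* v|_D is in L^2(D), stated for the extension of v|_D by zero. *)
Definition L2 (R : realType) (D : set R) (v : R -> R) : Prop :=
  v \_ D \in Lfun (@lebesgue_measure R) 2%:E.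

(* C_c^oo(D), for D open. *)
Definition test_function (R : realType) (D : set R) (t : R -> R) : Prop :=
  [/\ forall n x, derivable t^`(n)%classic x 1,
      compact (closure [set x | t x != 0]) &
      closure [set x | t x != 0] `<=` D].

(* g is a square-integrable weak derivative of v on D. *)
Definition weak_derivative (R : realType) (D : set R) (v g : R -> R) : Prop :=
  L2 D g /\
  forall t, test_function D t ->
    \int[lebesgue_measure]_(x in D) (v x * t^`()%classic x) =
    - \int[lebesgue_measure]_(x in D) (g x * t x).

Definition H1 (R : realType) (D : set R) (v : R -> R) : Prop :=
  L2 D v /\ exists g, weak_derivative D v g.

(* The weak derivative of v on D; it is only determined almost everywhere on D,
   so a representative is chosen.  Zero is a junk value, for v not in H1 D. *)
Definition wderiv (R : realType) (D : set R) (v : R -> R) : R -> R :=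
  xget (fun=> 0) [set g | weak_derivative D v g].

(* H^1_0(0,1), through the representatives that are continuous on [0,1]. *)
Definition H10 (R : realType) (v : R -> R) : Prop :=
  [/\ H1 `]0, 1[ v, {within `[0, 1], continuous v}, v 0 = 0 & v 1 = 0].

Definition admissible (R : realType) (phi : R) : set (R -> R) :=
  [set v | H10 v /\
    {ae (@lebesgue_measure R), forall x, x \in `]0, 1[ -> phi <= v x}].

Definition energy (R : realType) (f : R) (v : R -> R) : R :=
  1 / 2 * (\int[lebesgue_measure]_(x in `]0, 1[) (wderiv `]0, 1[ v x) ^+ 2)
  - \int[lebesgue_measure]_(x in `]0, 1[) (f * v x).

(* J(u) = inf_(v in K) J(v); the infimum is taken in the extended reals because
   the real-valued inf returns 0 on sets that are not bounded below. *)
Definition obstacle_solution (R : realType) (f phi : R) (u : R -> R) : Prop :=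
  admissible phi u /\
  (energy f u)%:E = ereal_inf [set (energy f v)%:E | v in admissible phi].

(* Main.v *)
Require Import Defs.
From HB Require Import structures.
From mathcomp Require Import all_boot all_order all_algebra.
From mathcomp Require Import all_classical all_reals all_analysis.
From mathcomp Require Import measurable_realfun ring lra.

Import Order.TTheory GRing.Theory Num.Theory.
Import numFieldNormedType.Exports.

Local Open Scope classical_set_scope.
Local Open Scope ring_scope.

(** Both cases are the same free-boundary problem with contact set [c, 1 - c]:
    c = 1/2 in case (1), c = sqrt(2 phi / f) in case (2).  With
    psi(x) = (c - x)^+ - (x - (1 - c))^+, which vanishes on the contact set,
    integrating [v'] against [psi] by parts on (0, c) and (1 - c, 1) gives, for
    every [v] in H^1_0(0,1),

      J(v) = 1/2 |v' - f psi|^2 - f^2 c^3 / 3 - f \int_c^(1-c) v.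

    As f < 0, the constraint v >= phi bounds the last term from below, with
    equality for the C^1 function [w] such that w' = f psi and w(0) = 0.
    So J(u) <= J(w) forces u' = f psi a.e., hence u = w.

    The integration by parts only uses the definition of the weak derivative: it
    is tested against [q (s_n - t_n)], where [q] is affine and [s_n], [t_n] are
    smooth steps with [s_n - t_n] tending to the indicator of an interval. *)

(** * Smooth steps *)

Lemma is_derive_affine {R : realType} (s t x : R) :
  is_derive x 1 (fun y : R => s * y + t) s.
Proof.
have -> : (fun y => s * y + t) = (cst s * id + cst t :> (R -> R)) by exact/funext.
by apply: is_derive_eq; rewrite /= /GRing.scale/=; ring.
Qed.

(** * Functions flat at the origin *)

Section flat_functions.
Context {R : realType}.
Implicit Types (P : {poly R}) (x y : R).

(** Each monomial is dominated by one term of the exponential series, [y ^+ i <= i! * expR y] for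
    [y > 0], so the sum of the [|P_i| * i!] serves as the bound. *)
Lemma poly_expRN_bounded P :
  exists C : R, forall y, 0 < y -> `|P.[y]| * expR (- y) <= C.
Proof.
elim/poly_ind: P => [|P c _].
  by exists 0 => y y0; rewrite horner0 normr0 mul0r.
set Q := P * 'X + c%:P.
exists (\sum_(i < size Q) `|Q`_i| * i`!%:R) => y y0.
rewrite horner_coef (le_trans (ler_wpM2r (expR_ge0 _) (ler_norm_sum _ _ _)))//.
rewrite mulr_suml; apply: ler_sum => i _.
rewrite normrM -mulrA ler_wpM2l// normrX gtr0_norm//.
rewrite expRN ler_pdivrMr ?expR_gt0//.
case: (i : nat) => [|n].
  by rewrite expr0 fact0 mul1r -expR0 ler_expR ltW.
have := expR_ge1Dxn n (ltW y0).
have f0 : (0 : R) < n.+1`!%:R by rewrite ltr0n fact_gt0.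
move=> H; have {}H : y ^+ n.+1 / n.+1`!%:R <= expR y.
  by apply: le_trans H; rewrite lerDr.
by rewrite -ler_pdivrMl// mulrC.
Qed.

(** Every derivative of exp(-1/y), extended by zero to y <= 0, has this shape. Indexing by the
    polynomial makes the family closed under differentiation. *)
Definition flat P y : R := if 0 < y then P.[y^-1] * expR (- y^-1) else 0.

(** For y > 0 the quotient of [flat P y] by y is [flat (P * 'X) y], which is bounded by the previous
    lemma. *)
Lemma flat_linear_bound P : exists C : R, forall y, `|flat P y| <= C * `|y|.
Proof.
have [C CP] := poly_expRN_bounded (P * 'X).
exists C => y; rewrite /flat; case: ifPn => y0; last first.
  rewrite normr0 mulr_ge0//.
  by apply: le_trans (CP 1 ltr01); rewrite mulr_ge0// expR_ge0.
rewrite -ler_pdivrMr ?normr_gt0 ?gt_eqF//.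
have yV0 : 0 < y^-1 by rewrite invr_gt0.
apply: le_trans (CP _ yV0); rewrite hornerM hornerX !normrM.
by rewrite (gtr0_norm (expR_gt0 _)) normfV mulrAC.
Qed.

Lemma flat_continuous0 P : {for 0, continuous (flat P)}.
Proof.
have [C HC] := flat_linear_bound P.
have f0 : flat P 0 = 0 by rewrite /flat ltxx.
rewrite /prop_for /continuous_at f0.
apply/cvgr0Pnorm_le => e e0.
have C0 : 0 < `|C| + 1 by rewrite ltr_wpDl.
near=> y.
apply: le_trans (HC y) _.
have : `|y| <= e / (`|C| + 1).
  near: y; exact: (@nbhs0_le R R^o _ (divr_gt0 e0 C0)).
rewrite ler_pdivlMr// mulrC => H; apply: le_trans H.
by rewrite ler_wpM2r// (le_trans (ler_norm _))// lerDl.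
Unshelve. all: by end_near. Qed.

(** With z = 1/y one has d/dy = -z^2 d/dz, and P(z) exp(-z) has z-derivative (P' - P)(z) exp(-z);
    this gives the polynomial X^2 (P - P'). *)
Lemma is_derive_flat P y :
  is_derive y 1 (flat P) (flat ('X^2 * (P - P^`())) y).
Proof.
have [y0|y0|->] := ltgtP y 0.
- apply: (near_eq_is_derive (f := cst 0)).
    near=> z; rewrite /flat ltNge ifF//; apply/negbF/ltW.
    by near: z; exact: lt_nbhsl.
  by apply: is_derive_eq; rewrite /flat ltNge ltW.
- apply: (near_eq_is_derive (f := fun z : R => P.[z^-1] * expR (- z^-1))).
    near=> z; rewrite /flat ifT//.
    by near: z; exact: lt_nbhsr.
  have dV : is_derive y 1 (fun z : R => z^-1) (- y ^- 2).
    have := @is_deriveV R id y 1 1.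
    by rewrite gt_eqF// => /(_ isT _); rewrite [_ *: 1]mulr1; apply.
  have dP := @is_derive1_comp R (horner P) _ y _ _ _ dV.
  have dN : is_derive y 1 (fun z : R => - z^-1) (y ^- 2).
    by have := is_deriveN dV; rewrite opprK.
  have dE := @is_derive1_comp R (@expR R) _ y _ _ _ dN.
  apply: is_derive_eq.
  rewrite /flat y0 !hornerE /= /GRing.scale /= !exprVn; ring.
(* The difference quotient of [flat P] at 0 is [flat (P * 'X)], which is continuous at 0 with value
   0. *)
- apply/is_derive1_caratheodory; exists (flat (P * 'X)); split.
  + move=> z; rewrite /flat ltxx !subr0; case: ifPn => z0; last by rewrite mul0r.
    by rewrite hornerM hornerX; field; rewrite gt_eqF.
  + exact: flat_continuous0.
  + by rewrite /flat ltxx.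
Unshelve. all: by end_near. Qed.

End flat_functions.

(** * A class of smooth functions containing steps *)

Section smooth_functions.
Context {R : realType}.

(* A class of functions closed under differentiation, hence smooth. *)
Inductive elementary : (R -> R) -> Prop :=
| elementary_cst c : elementary (cst c)
| elementary_id : elementary id
| elementary_flat P (s t : R) : elementary (fun x => flat P (s * x + t))
| elementaryD f g : elementary f -> elementary g -> elementary (f + g)
| elementaryM f g : elementary f -> elementary g -> elementary (f * g)
| elementaryV f : (forall x, f x != 0) -> elementary f ->
    elementary (fun x => (f x)^-1).

Lemma elementary_is_derive f : elementary f ->
  exists2 f' : R -> R, elementary f' & forall x : R, is_derive x 1 f (f' x).
Proof.
elim=> {f} [c||P s t|f g _ [f' ef' df] _ [g' eg' dg]
  |f g ef [f' ef' df] eg [g' eg' dg]|f f0 ef [f' ef' df]].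
- by exists (cst 0); [exact: elementary_cst|move=> x; exact: is_derive_cst].
- by exists (cst 1); [exact: elementary_cst|move=> x; exact: is_derive_id].
- exists ((fun x => flat ('X^2 * (P - P^`())) (s * x + t)) * cst s).
    by apply: elementaryM; [exact: elementary_flat|exact: elementary_cst].
  move=> x; exact: (@is_derive1_comp R (flat P) (fun x => s * x + t) x _ _
    (is_derive_flat P _) (is_derive_affine s t x)).
- by exists (f' + g'); [exact: elementaryD|move=> x; exact: is_deriveD].
- exists (f * g' + g * f').
    by apply: elementaryD; exact: elementaryM.
  by move=> x; exact: is_deriveM.
- exists (cst (-1) * ((fun x => (f x)^-1) * (fun x => (f x)^-1)) * f').
    apply: elementaryM => //; apply: elementaryM; first exact: elementary_cst.
    by apply: elementaryM; exact: elementaryV.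
  move=> x; apply: (is_derive_eq (is_deriveV (f0 x) (df x))).
  by rewrite /GRing.scale /= fctE; congr (_ * _); rewrite expr2 invfM mulN1r.
Qed.

Lemma elementary_derive1 f : elementary f -> elementary f^`()%classic.
Proof.
move=> /elementary_is_derive[f' ef' df].
rewrite (_ : f^`()%classic = f')//; apply/funext => x.
by rewrite derive1E derive_val.
Qed.

Lemma elementary_derivable f x : elementary f -> derivable f x 1.
Proof. by move=> /elementary_is_derive[f' _ /(_ x)[]]. Qed.

Lemma elementary_smooth f : elementary f ->
  forall n x, derivable f^`(n)%classic x 1.
Proof.
move=> ef n x; apply: elementary_derivable; elim: n => [//|n ih].
by rewrite derive1nS; exact: elementary_derive1.
Qed.

Lemma elementary_continuous f : elementary f -> continuous f.
Proof.
move=> ef x; apply/differentiable_continuous/derivable1_diffP.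
exact: elementary_derivable.
Qed.

Lemma elementaryN f : elementary f -> elementary (- f).
Proof.
move=> ef; rewrite (_ : - f = cst (-1) * f).
  by apply: elementaryM => //; exact: elementary_cst.
by apply/funext => x; rewrite !fctE mulN1r.
Qed.

(** A smoothed Heaviside function. The sign of the derivative makes it a probability density carried
    by [a, b], hence an approximate Dirac mass when the interval is short. *)
Definition smooth_step (a b : R) (s : R -> R) :=
  [/\ elementary s, forall x, x <= a -> s x = 0, forall x, b <= x -> s x = 1,
      forall x, 0 <= s x <= 1 & forall x, 0 <= s^`()%classic x].

(** The step is h / (h + k) with h = exp(-1/(x - a)) and k = exp(-1/(b - x)), each extended by zero.
    As a < b, at every point at least one of them is positive. *)
Lemma smooth_step_exists (a b : R) : a < b -> exists s, smooth_step a b s.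
Proof.
move=> ab.
have flat_ge0 x : 0 <= flat 1 x.
  by rewrite /flat; case: ifP => // _; rewrite hornerC mul1r expR_ge0.
have flat_gt0 x : 0 < x -> 0 < flat 1 x.
  by move=> x0; rewrite /flat x0 hornerC mul1r expR_gt0.
have flat_eq0 x : x <= 0 -> flat 1 x = 0 by rewrite /flat ltNge => ->.
pose h x := flat 1 (1 * x + - a); pose k x := flat 1 (-1 * x + b).
have hk x : 0 < h x + k x.
  have [xa|ax] := leP x a.
    by rewrite ltr_wpDl ?flat_ge0// /k flat_gt0//; lra.
  by rewrite ltr_wpDr ?flat_ge0// /h flat_gt0//; lra.
have eh : elementary h by exact: elementary_flat.
have ek : elementary k by exact: elementary_flat.
pose s := h * (fun x => ((h + k) x)^-1).
exists s.
have es : elementary s.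
  apply: elementaryM => //; apply: elementaryV; last exact: elementaryD.
  by move=> x; rewrite fctE gt_eqF.
split => // [x xa|x bx|x|x].
- by rewrite /s fctE /h flat_eq0 ?mul0r//; lra.
- rewrite /s !fctE [X in _ + X](_ : _ = 0) ?addr0; last first.
    by rewrite /k flat_eq0//; lra.
  by rewrite divff// gt_eqF// /h flat_gt0//; lra.
- rewrite /s !fctE; apply/andP; split.
    by rewrite divr_ge0 ?flat_ge0// ltW.
  by rewrite ler_pdivrMr// mul1r lerDl flat_ge0.
(* The derivative of [k] is [- k'], so the quotient rule has numerator [h' * k + h * k'], a sum of
   nonnegative terms. *)
- pose h' x := flat ('X^2 * (1 - (1 : {poly R})^`())) (1 * x + - a).
  pose k' x := flat ('X^2 * (1 - (1 : {poly R})^`())) (-1 * x + b).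
  have flat'_ge0 y : 0 <= flat ('X^2 * (1 - (1 : {poly R})^`())) y.
    rewrite /flat; case: ifP => // y0.
    by rewrite derivC subr0 mulr1 hornerXn mulr_ge0 ?expR_ge0 ?exprn_ge0// invr_ge0 ltW.
  have dh : is_derive x 1 h (h' x * 1).
    exact: (@is_derive1_comp R (flat 1) _ x _ _ (is_derive_flat _ _) (is_derive_affine _ _ _)).
  have dk : is_derive x 1 k (k' x * -1).
    exact: (@is_derive1_comp R (flat 1) _ x _ _ (is_derive_flat _ _) (is_derive_affine _ _ _)).
  have dhk := is_deriveD dh dk.
  have hk0 : (h + k) x != 0 by rewrite fctE gt_eqF.
  have ds := is_deriveM dh (is_deriveV hk0 dhk).
  rewrite derive1E derive_val /GRing.scale /= !fctE.
  rewrite (_ : _ + _ = (h' x * k x + h x * k' x) / (h x + k x) ^+ 2); last first.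
    by field; rewrite gt_eqF.
  by rewrite divr_ge0 ?sqr_ge0// addr_ge0// mulr_ge0// ?flat_ge0// flat'_ge0.
Qed.

End smooth_functions.

(** * Integration by parts for weak derivatives *)

Section integrals.
Context {R : realType}.
Notation mu := (@lebesgue_measure R).
Implicit Types (a b l r : R) (V s : R -> R).

Lemma within_continuous_integrable_oo a b V :
  {within `[a, b], continuous V} -> mu.-integrable `]a, b[ (EFin \o V).
Proof.
move=> cV; apply: (@integrableS _ _ _ mu `[a, b]) => //.
  exact: subset_itv_oo_cc.
by apply: continuous_compact_integrable => //; exact: segment_compact.
Qed.

Lemma Rintegral_itv_oo_cc a b V : {within `[a, b], continuous V} ->
  \int[mu]_(x in `]a, b[) V x = \int[mu]_(x in `[a, b]) V x.
Proof.
move=> cV; rewrite Rintegral_itv_obnd_cbnd.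
  rewrite Rintegral_itv_bndo_bndc//.
  apply: (@integrableS _ _ _ mu `[a, b]) => //.
    exact: subset_itv_co_cc.
  by apply: continuous_compact_integrable => //; exact: segment_compact.
exact: within_continuous_integrable_oo.
Qed.

Lemma Rintegral_derive1 a b V : a < b ->
    (forall x, derivable V x 1) -> continuous V^`()%classic ->
  \int[mu]_(x in `]a, b[) V^`()%classic x = V b - V a.
Proof.
move=> ab dV cV'.
have cV : continuous V.
  by move=> x; apply/differentiable_continuous/derivable1_diffP.
have cV'ab : {within `[a, b], continuous V^`()%classic}.
  exact: continuous_subspaceT.
rewrite Rintegral_itv_oo_cc// /Rintegral (continuous_FTC2 (F := V))//.
split=> //.
- exact/cvg_at_right_filter/cV.
- exact/cvg_at_left_filter/cV.
Qed.

Lemma smooth_step_derive1_support a b s x : smooth_step a b s ->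
  s^`()%classic x != 0 -> a <= x <= b.
Proof.
move=> [_ s0 s1 _ _] s'x; apply/andP; split; rewrite leNgt; apply/negP => xab.
- move/eqP: s'x; apply; rewrite derive1E (near_eq_derive (g := cst (0 : R))).
    by rewrite derive_cst.
  by near=> z; rewrite s0//; near: z; exact: lt_le_nbhsl.
- move/eqP: s'x; apply; rewrite derive1E (near_eq_derive (g := cst (1 : R))).
    by rewrite derive_cst.
  by near=> z; rewrite s1//; near: z; exact: lt_le_nbhsr.
Unshelve. all: by end_near. Qed.

Lemma elementary_within_continuous a b V : elementary V ->
  {within `[a, b], continuous V}.
Proof. by move=> eV; apply: continuous_subspaceT; exact: elementary_continuous. Qed.

Lemma within_continuousM a b V W :
  {within `[a, b], continuous V} -> {within `[a, b], continuous W} ->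
  {within `[a, b], continuous (fun x => V x * W x)}.
Proof. by move=> cV cW x; apply: continuousM; [exact: cV|exact: cW]. Qed.

(** The integral is the mean of [V] for a probability density carried by [a, b], where [V] stays
    within [e] of [c]. *)
Lemma dist_smooth_step_mean l r a b s V (c e : R) :
    {within `[l, r], continuous V} -> smooth_step a b s ->
    l <= a -> a < b -> b <= r ->
    (forall x, a <= x <= b -> `|V x - c| <= e) ->
  `|\int[mu]_(x in `]l, r[) (V x * s^`()%classic x) - c| <= e.
Proof.
move=> cV hs la ab br Vc; have [es s0 s1 _ s'_ge0] := hs.
have lr : l < r by rewrite (le_lt_trans la)// (lt_le_trans ab).
have es' := elementary_derive1 _ es.
have cs' := elementary_within_continuous l r _ es'.
have is' := within_continuous_integrable_oo _ _ _ cs'.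
have iVs' := within_continuous_integrable_oo _ _ _ (within_continuousM _ _ _ _ cV cs').
have ints' : \int[mu]_(x in `]l, r[) s^`()%classic x = 1.
  rewrite (Rintegral_derive1 l r s lr).
  - by rewrite (s0 l)// (s1 r)// subr0.
  - by move=> x; exact: elementary_derivable.
  - exact: elementary_continuous.
have cB : \int[mu]_(x in `]l, r[) (V x * s^`()%classic x) - c =
    \int[mu]_(x in `]l, r[) (V x * s^`()%classic x - c * s^`()%classic x).
  rewrite RintegralB//; last first.
    apply: within_continuous_integrable_oo.
    by apply: within_continuousM => // x; exact: cvg_cst.
  by rewrite RintegralZl// ints' mulr1.
have iVcs' : mu.-integrable `]l, r[
    (EFin \o (fun x => V x * s^`()%classic x - c * s^`()%classic x)).
  apply: within_continuous_integrable_oo.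
  apply: (@within_continuousB _ _ _ _ (fun x => V x * s^`()%classic x)
    (fun x => c * s^`()%classic x)); first exact: within_continuousM.
  by apply: within_continuousM => // y; exact: cvg_cst.
rewrite cB (le_trans (le_normr_Rintegral _ _))//.
rewrite -[leRHS]mulr1 -ints' -RintegralZl//.
apply: le_Rintegral => //.
- exact: (integrable_norm iVcs').
- by apply: within_continuous_integrable_oo; apply: within_continuousM => // y; exact: cvg_cst.
- move=> x _; rewrite -mulrBl normrM (ger0_norm (s'_ge0 x)).
  have [->|s'x] := eqVneq (s^`()%classic x) 0; first by rewrite !mulr0.
  by rewrite ler_wpM2r// Vc//; exact: smooth_step_derive1_support hs s'x.
Qed.

(** The densities [s_n'] concentrate at [p]. Since their intervals stay inside [l, r], continuity
    within [l, r] is enough, also when [p] is an endpoint. *)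
Lemma cvg_smooth_step_mean l r (p : R) (a b : R^nat) (s : nat -> R -> R) V :
    {within `[l, r], continuous V} -> p \in `[l, r] ->
    (forall n, smooth_step (a n) (b n) (s n)) ->
    (forall n, [/\ l <= a n, a n < b n & b n <= r]) ->
    a @ \oo --> p -> b @ \oo --> p ->
  \int[mu]_(x in `]l, r[) (V x * (s n)^`()%classic x) @[n --> \oo] --> V p.
Proof.
move=> cV plr hs lab ap bp.
apply/cvgrPdist_le => e e0.
have /subspace_continuousP/(_ p plr)/cvgrPdist_le/(_ _ e0) := cV.
rewrite near_withinE => /nbhs_ballP[d d0 pd].
have /cvgrPdist_lt/(_ _ d0) ad := ap; have /cvgrPdist_lt/(_ _ d0) bd := bp.
near=> n.
have [la ab br] := lab n.
rewrite distrC; apply: (dist_smooth_step_mean _ _ _ _ _ _ _ _ cV (hs n)) => // x /andP[ax xb].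
rewrite distrC; apply: pd.
- have : `|p - a n| < d by near: n; exact: ad.
  have : `|p - b n| < d by near: n; exact: bd.
  rewrite /ball/= !ltr_norml => /andP[? ?] /andP[? ?]; lra.
- by rewrite /= in_itv/= (le_trans la)// (le_trans xb).
Unshelve. all: by end_near. Qed.

(** Dominated convergence, with [|h|] as the dominating function. *)
Lemma cvg_Rintegral_indic (D A : set R) (h : R -> R) (t : nat -> R -> R) :
    measurable D -> measurable A -> A `<=` D ->
    mu.-integrable D (EFin \o h) ->
    (forall n, measurable_fun D (t n)) ->
    (forall n x, D x -> `|t n x| <= 1) ->
    (forall x, D x -> t n x @[n --> \oo] --> (\1_A x : R)) ->
  \int[mu]_(x in D) (h x * t n x) @[n --> \oo] --> \int[mu]_(x in A) h x.
Proof.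
move=> mD mA AD ih mt t1 tA.
have mh : measurable_fun D h by apply/measurable_EFinP; exact: measurable_int ih.
have [] := @dominated_convergence _ _ _ mu D mD
  (fun n => EFin \o (fun x => h x * t n x))
  (EFin \o (fun x => h x * \1_A x)) (EFin \o (fun x => `|h x|)).
- by move=> n; apply/measurable_EFinP; exact: (measurable_funM mh (mt n)).
- apply/measurable_EFinP.
  exact: (measurable_funM mh (@measurable_indic _ _ _ _ A mA)).
- apply: aeW => x Dx; apply: cvg_EFin; first exact: nearW.
  by apply: cvgM; [exact: cvg_cst|exact: tA].
- exact: (integrable_norm ih).
- apply: aeW => x n Dx; rewrite /= lee_fin normrM.
  by rewrite -[leRHS]mulr1 ler_wpM2l// t1.
move=> ihA _ cvg_int.
have -> : \int[mu]_(x in A) h x = \int[mu]_(x in D) (h x * \1_A x).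
  rewrite -(setIidr AD) Rintegral_mkcondr (setIidr AD); apply: eq_Rintegral => x xD.
  by rewrite patchE indicE; case: ifPn => _; rewrite ?mulr1 ?mulr0.
apply: fine_cvg; rewrite fineK; first exact: cvg_int.
exact: integrable_fin_num ihA.
Qed.

End integrals.

(** * Square-integrable functions *)

Section L2.
Context {R : realType}.
Notation mu := (@lebesgue_measure R).
Implicit Types (D : set R) (f g h : R -> R).

Lemma L2_measurable D g : measurable D -> L2 D g -> measurable_fun D g.
Proof.
move=> mD; rewrite /L2 inE => /andP[+ _]; rewrite inE/= => mg.
by apply: ((measurable_restrictT g mD).2); exact: mg.
Qed.

Lemma L2_sqr_integrable D g : measurable D -> L2 D g ->
  mu.-integrable D (EFin \o (fun x => g x ^+ 2)).
Proof.
move=> mD /Lfun2_integrable_sqr/integrableS-/(_ D measurableT mD (@subsetT _ _)).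
apply: eq_integrable => // x xD.
by rewrite /= patchE xD.
Qed.

Lemma L2_mul_integrable D g h : measurable D -> L2 D g -> L2 D h ->
  mu.-integrable D (EFin \o (fun x => g x * h x)).
Proof.
move=> mD Lg Lh.
have := Lfun2_mul_Lfun1 Lg Lh.
move=> /Lfun1_integrable/integrableS-/(_ D measurableT mD (@subsetT _ _)).
apply: eq_integrable => // x xD.
by rewrite /= !patchE xD.
Qed.

Lemma L2_within_continuous (a b : R) g : {within `[a, b], continuous g} ->
  L2 `]a, b[ g.
Proof.
move=> cg.
have cg2 : {within `[a, b], continuous (fun x => g x * g x)}.
  exact: within_continuousM.
have mg : measurable_fun `]a, b[ g.
  apply/measurable_EFinP.
  exact: measurable_int (within_continuous_integrable_oo _ _ _ cg).
have mg' : measurable_fun setT (g \_ `]a, b[).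
  by apply/(measurable_restrictT _ _).1.
have ig : mu.-integrable setT (EFin \o ((fun x => g x * g x) \_ `]a, b[)).
  rewrite -restrict_EFin; apply/integrable_restrict => //; rewrite setTI.
  exact: within_continuous_integrable_oo.
rewrite /L2 inE; apply/andP; split; first by rewrite inE; exact: mg'.
rewrite inE /= /finite_norm unlock /Lnorm poweR_lty//.
under eq_integral => x _.
  rewrite /= powR_mulrn// -normrX ger0_norm ?sqr_ge0// expr2.
  rewrite (_ : _ * _ = ((fun x => g x * g x) \_ `]a, b[) x); last first.
    by rewrite !patchE; case: ifPn => _; rewrite ?mulr0.
  over.
exact: integrable_lty ig.
Qed.

End L2.

(** * Weak derivatives on an open interval *)

Section weak_derivative.
Context {R : realType}.
Notation mu := (@lebesgue_measure R).
Implicit Types (a b l r : R) (g q V : R -> R).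

Lemma elementary_test_function l r a b q : elementary q ->
    (forall x, q x != 0 -> a <= x <= b) -> l < a -> b < r ->
  test_function `]l, r[ q.
Proof.
move=> eq qab la br.
have sub : closure [set x | q x != 0] `<=` `[a, b].
  rewrite (_ : `[a, b]%classic = closure `[a, b]).
    by apply: closure_subset => x /= /qab; rewrite in_itv.
  by apply/closure_id; exact: interval_closed.
split; first exact: elementary_smooth.
- apply: subclosed_compact sub; [exact: closed_closure|exact: segment_compact].
- apply: subset_trans sub _ => x /=; rewrite !in_itv/= => /andP[ax xb].
  by rewrite (lt_le_trans la)// (le_lt_trans xb).
Qed.

(** The steps rise strictly inside ]a, b[, so [q * (s n - t n)] is a legitimate test function even
    when a = l or b = r. In the limit the terms with [s_n'] and [t_n'] become the boundary values at
    [a] and [b]. *)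
Lemma weak_derivative_by_parts l r a b V g q :
    {within `[l, r], continuous V} -> weak_derivative `]l, r[ V g ->
    elementary q -> l <= a -> a < b -> b <= r ->
  \int[mu]_(x in `]a, b[) (g x * q x) =
  V b * q b - V a * q a - \int[mu]_(x in `]a, b[) (V x * q^`()%classic x).
Proof.
move=> cV [Lg wg] eq la ab br.
have cq := elementary_within_continuous l r _ eq.
have cq' := elementary_within_continuous l r _ (elementary_derive1 _ eq).
have igq : mu.-integrable `]l, r[ (EFin \o (fun x => g x * q x)).
  by apply: L2_mul_integrable => //; exact: L2_within_continuous.
have iVq' : mu.-integrable `]l, r[ (EFin \o (fun x => V x * q^`()%classic x)).
  by apply: within_continuous_integrable_oo; exact: within_continuousM.
have ab_lr : `]a, b[ `<=` `]l, r[ by exact: subset_itvSoo.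
(* The step [s n] will rise on [a + e, a + 2e] and [t n] on [b - 2e, b - e]; the factor 1/4 gives a
   + 2e <= b - 2e, so [s n - t n] lies between 0 and 1. *)
pose e n : R := (b - a) / 4 * n.+1%:R^-1.
have e_gt0 n : 0 < e n by rewrite mulr_gt0 ?divr_gt0 ?subr_gt0.
have e_le n : e n <= (b - a) / 4.
  by rewrite ler_piMr ?divr_ge0 ?subr_ge0 ?(ltW ab)// invf_le1// ler1n.
have e_cvg0 : e @ \oo --> 0.
  rewrite -[X in _ --> X](mulr0 ((b - a) / 4)).
  by apply: cvgM; [exact: cvg_cst|exact: cvg_harmonic].
have e_affine (c d : R) : c + d * e n @[n --> \oo] --> c.
  rewrite -[X in _ --> X]addr0; apply: cvgD; first exact: cvg_cst.
  by rewrite -[X in _ --> X](mulr0 d); apply: cvgM => //; exact: cvg_cst.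
have /choice[s hs] : forall n, exists s, smooth_step (a + 1 * e n) (a + 2 * e n) s.
  by move=> n; apply: smooth_step_exists; have := e_gt0 n; lra.
have /choice[t ht] : forall n, exists t, smooth_step (b + -2 * e n) (b + -1 * e n) t.
  by move=> n; apply: smooth_step_exists; have := e_gt0 n; lra.
have es n : elementary (s n) by case: (hs n).
have et n : elementary (t n) by case: (ht n).
have est n : elementary (s n - t n) by apply: elementaryD => //; exact: elementaryN.
have st0 n x : (s n - t n) x != 0 -> a + e n <= x <= b - e n.
  have [_ s0 s1 _ _] := hs n; have [_ t0 t1 _ _] := ht n.
  have := e_gt0 n; have := e_le n => ele egt; rewrite !fctE => stx.
  apply/andP; split; rewrite leNgt; apply: contra stx => xab; apply/eqP.
    by rewrite s0 ?t0; lra.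
  by rewrite s1 ?t1; lra.
have st_le1 n x : `|(s n - t n) x| <= 1.
  have [_ _ _ + _] := hs n; have [_ _ _ + _] := ht n.
  by rewrite !fctE ler_norml => /(_ x)/andP[? ?] /(_ x)/andP[? ?]; lra.
have st_cvg x : (s n - t n) x @[n --> \oo] --> (\1_`]a, b[ x : R).
  rewrite indicE mem_setE; case: (boolP (x \in `]a, b[)); rewrite in_itv/=.
    move=> /andP[ax xb]; apply: cvg_near_cst.
    have := e_affine a 2; have := e_affine b (-2).
    move=> /cvgr_gt/(_ _ xb) ? /cvgr_lt/(_ _ ax) ?.
    near=> n; have [_ _ s1 _ _] := hs n; have [_ t0 _ _ _] := ht n.
    rewrite !fctE s1 ?t0 ?subr0//.
      by apply: ltW; near: n.
    by apply: ltW; near: n.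
  move=> xab; apply: cvg_near_cst; apply: nearW => n.
  apply/eqP; apply: contraNT xab => /st0; have := e_gt0 n; lra.
have mst (D : set R) n : measurable_fun D (s n - t n).
  apply: measurable_funTS; apply: continuous_measurable_fun.
  exact: elementary_continuous.
(* The weak identity for this test function, with its derivative expanded as q'(s - t) + q s' - q
   t'. *)
have wst n : \int[mu]_(x in `]l, r[) (V x * q^`()%classic x * (s n - t n) x) +
     \int[mu]_(x in `]l, r[) (V x * q x * (s n)^`()%classic x) -
     \int[mu]_(x in `]l, r[) (V x * q x * (t n)^`()%classic x) =
     - \int[mu]_(x in `]l, r[) (g x * q x * (s n - t n) x).
  have : test_function `]l, r[ (q * (s n - t n)).
    apply: (@elementary_test_function _ _ (a + e n) (b - e n)).
    - exact: elementaryM.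
    - by move=> x; rewrite fctE mulf_eq0 negb_or => /andP[_ /st0].
    - by have := e_gt0 n; lra.
    - by have := e_gt0 n; lra.
  move=> /wg; under [in RHS]eq_Rintegral do rewrite fctE mulrA.
  move=> <-.
  have cst := elementary_within_continuous l r _ (est n).
  have cs' := elementary_within_continuous l r _ (elementary_derive1 _ (es n)).
  have ct' := elementary_within_continuous l r _ (elementary_derive1 _ (et n)).
  rewrite -RintegralD//; [|apply: within_continuous_integrable_oo..]; last 2 first.
    by do 2 apply: within_continuousM => //.
    by do 2 apply: within_continuousM => //.
  rewrite -RintegralB//; last 2 first.
    apply: within_continuous_integrable_oo.
    apply: (@within_continuousD _ _ _ _
      (fun x => V x * q^`()%classic x * (s n - t n) x)
      (fun x => V x * q x * (s n)^`()%classic x)).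
      by do 2 apply: within_continuousM => //.
    by do 2 apply: within_continuousM => //.
    apply: within_continuous_integrable_oo.
    by do 2 apply: within_continuousM => //.
  apply: eq_Rintegral => x _.
  rewrite [in RHS]derive1E deriveM; last 2 first.
    exact: elementary_derivable.
    exact: elementary_derivable.
  rewrite deriveB; last 2 first.
    exact: elementary_derivable.
    exact: elementary_derivable.
  rewrite -!derive1E /GRing.scale/= !fctE; ring.
(* The integrals with [s n - t n] tend to integrals over ]a, b[, those with [s_n'] and [t_n'] to the
   values of [V * q] at [a] and [b]. Uniqueness of limits then concludes. *)
have lim1 := @cvg_Rintegral_indic R _ _ _ _ (measurable_itv `]l, r[)
  (measurable_itv `]a, b[) ab_lr iVq' (mst _) (fun n x _ => st_le1 n x) (fun x _ => st_cvg x).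
have lim4 := @cvg_Rintegral_indic R _ _ _ _ (measurable_itv `]l, r[)
  (measurable_itv `]a, b[) ab_lr igq (mst _) (fun n x _ => st_le1 n x) (fun x _ => st_cvg x).
have cVq : {within `[l, r], continuous (fun x => V x * q x)} by exact: within_continuousM.
have lim2 := cvg_smooth_step_mean l r a _ _ s _ cVq _ hs _ (e_affine _ _) (e_affine _ _).
have lim3 := cvg_smooth_step_mean l r b _ _ t _ cVq _ ht _ (e_affine _ _) (e_affine _ _).
have {}lim2 : \int[mu]_(x in `]l, r[) (V x * q x * (s n)^`()%classic x) @[n --> \oo]
    --> V a * q a.
  apply: lim2; first by rewrite in_itv/= la ltW// (lt_le_trans ab).
  by move=> n; have := e_gt0 n; have := e_le n; split; lra.
have {}lim3 : \int[mu]_(x in `]l, r[) (V x * q x * (t n)^`()%classic x) @[n --> \oo]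
    --> V b * q b.
  apply: lim3; first by rewrite in_itv/= br ltW// (le_lt_trans la).
  by move=> n; have := e_gt0 n; have := e_le n; split; lra.
have limL := cvgB (cvgD lim1 lim2) lim3.
have {}limL := limL eventually_filter eventually_filter.
have limR := cvgN lim4; have {}limR := limR eventually_filter.
have limE : (fun n => \int[mu]_(x in `]l, r[) (V x * q^`()%classic x * (s n - t n) x)) +
    (fun n => \int[mu]_(x in `]l, r[) (V x * q x * (s n)^`()%classic x)) -
    (fun n => \int[mu]_(x in `]l, r[) (V x * q x * (t n)^`()%classic x)) =
    - (fun n => \int[mu]_(x in `]l, r[) (g x * q x * (s n - t n) x)).
  by apply/funext => n; rewrite !fctE -wst.
rewrite limE in limL.
have H : \int[mu]_(x in `]a, b[) (V x * q^`()%classic x) + V a * q a - V b * q b =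
    - \int[mu]_(x in `]a, b[) (g x * q x) := cvg_unique (@Rhausdorff R) limL limR.
by rewrite -[LHS]opprK -H; ring.
Unshelve. all: by end_near. Qed.

(** Integration by parts against the constant 1. *)
Lemma weak_derivative_Rintegral l r a b V g :
    {within `[l, r], continuous V} -> weak_derivative `]l, r[ V g ->
    l <= a -> a < b -> b <= r ->
  \int[mu]_(x in `]a, b[) g x = V b - V a.
Proof.
move=> cV wg la ab br.
have := weak_derivative_by_parts l r a b V g (cst 1) cV wg (elementary_cst 1) la ab br.
under eq_Rintegral do rewrite mulr1.
under [in RHS]eq_Rintegral do rewrite derive1_cst mulr0.
by rewrite Rintegral_cst// mul0r subr0 !mulr1.
Qed.

(** On a bounded interval the constant 1 is in L^2, and a product of two L^2 functions is
    integrable. *)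
Lemma L2_itv_oo_integrable a b g : L2 `]a, b[ g ->
  mu.-integrable `]a, b[ (EFin \o g).
Proof.
move=> Lg.
have L1 : L2 `]a, b[ (cst (1 : R)).
  by apply: L2_within_continuous => x; exact: cvg_cst.
have := L2_mul_integrable `]a, b[ _ _ (measurable_itv _) Lg L1.
by apply: eq_integrable => // x _; rewrite /= mulr1.
Qed.

(** Both functions have the primitive V(y) - V(l), so the integral of their difference over ]l, y]
    vanishes for every y, and Lebesgue differentiation makes the difference zero a.e. This is what
    allows the chosen representative [wderiv] to be compared with an explicit derivative. *)
Lemma weak_derivative_ae_unique l r V g1 g2 :
    {within `[l, r], continuous V} ->
    weak_derivative `]l, r[ V g1 -> weak_derivative `]l, r[ V g2 ->
  ae_eq mu `]l, r[%classic g1 g2.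
Proof.
move=> cV wg1 wg2; pose h x := g1 x - g2 x.
have ig1 := L2_itv_oo_integrable _ _ _ wg1.1.
have ig2 := L2_itv_oo_integrable _ _ _ wg2.1.
have ih : mu.-integrable `]l, r[ (EFin \o h).
  by apply: (eq_integrable _ _ _ _ (integrableB _ ig1 ig2)).
have ihT : mu.-integrable setT (EFin \o (h \_ `]l, r[)).
  by rewrite -restrict_EFin; apply/integrable_restrict => //; rewrite setTI.
have := @FTC1 R (h \_ `]l, r[) (BRight l) _ (integrable_locally (measurable_itv _) ih).
set F := (fun x => Rintegral _ _ _).
have F0 y : y \in `]l, r[ -> F y = 0.
  rewrite in_itv/= => /andP[ly yr].
  have sub : `]l, y] `<=` `]l, r[ by apply: subset_itvl; rewrite bnd_simp.
  have suboo : `]l, y[ `<=` `]l, r[ by apply: subset_itvl; rewrite bnd_simp ltW.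
  have -> : F y = \int[mu]_(x in `]l, y]) h x.
    apply: eq_Rintegral => x; rewrite inE => xly.
    by rewrite patchE mem_set//; exact: sub.
  rewrite -Rintegral_itv_bndo_bndc; last exact: integrableS ih.
  rewrite RintegralB//; [|exact: integrableS ig1|exact: integrableS ig2].
  rewrite (weak_derivative_Rintegral _ _ _ _ _ _ cV wg1)//; last exact: ltW.
  rewrite (weak_derivative_Rintegral _ _ _ _ _ _ cV wg2)//; last exact: ltW.
  by rewrite subrr.
move=> /(_ _)[].
  by move=> y; exact: integrableS ihT.
move=> N [mN N0 subN]; exists N; split => // x /= nx; apply: subN => /= H.
apply: nx => xlr.
have /andP[lx xr] : l < x < r by move: xlr; rewrite /= in_itv.
have [_] := H lx.
(* The primitive [F] is zero in a neighbourhood of [x], so its derivative there, which is [h x], is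
   zero. *)
rewrite patchE mem_set// derive1E (near_eq_derive (g := cst (0 : R))).
  by rewrite derive_cst => /esym/eqP; rewrite subr_eq0 => /eqP.
near=> y; apply: F0; rewrite in_itv/=; apply/andP; split.
  by near: y; exact: lt_nbhsr.
by near: y; exact: lt_nbhsl.
Unshelve. all: by end_near. Qed.

(** The derivative of [V * t] integrates to zero because the test function [t] vanishes at [l] and
    [r]. *)
Lemma C1_weak_derivative l r V g : l < r -> (forall x : R, is_derive x 1 V (g x)) ->
  continuous g -> weak_derivative `]l, r[ V g.
Proof.
move=> lr dV cg; split.
  by apply: L2_within_continuous; exact: continuous_subspaceT.
move=> t [dt _ supp_t].
have cV : continuous V.
  by move=> x; apply/differentiable_continuous/derivable1_diffP; case: (dV x).
have ct : continuous t.
  by move=> x; apply/differentiable_continuous/derivable1_diffP; exact: (dt 0%N).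
have ct' : continuous t^`()%classic.
  by move=> x; apply/differentiable_continuous/derivable1_diffP; exact: (dt 1%N).
have dVt (x : R) : is_derive x 1 (V * t) (V x * t^`()%classic x + t x * g x).
  by rewrite derive1E; apply: is_deriveM; apply/derivableP; exact: (dt 0%N).
have dVtE : (V * t)^`()%classic = (fun x => V x * t^`()%classic x + t x * g x).
  by apply/funext => x; rewrite derive1E; case: (dVt x).
have t0 x : x \notin `]l, r[ -> t x = 0.
  apply: contraNeq => tx; apply: supp_t; exact: subset_closure.
have : \int[mu]_(x in `]l, r[) (V x * t^`()%classic x + t x * g x) = 0.
  rewrite -dVtE (Rintegral_derive1 l r _ lr).
  - by rewrite !fctE (t0 l) ?(t0 r) ?mulr0 ?subr0 ?in_itv/= ?ltxx ?andbF.
  - by move=> x; case: (dVt x).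
  - rewrite dVtE => x.
    exact: (cvgD (cvgM (cV x) (ct' x)) (cvgM (ct x) (cg x))).
rewrite RintegralD//; first last.
- apply: within_continuous_integrable_oo; apply: continuous_subspaceT => x.
  exact: (cvgM (ct x) (cg x)).
- apply: within_continuous_integrable_oo; apply: continuous_subspaceT => x.
  exact: (cvgM (cV x) (ct' x)).
move=> /eqP; rewrite addr_eq0 => /eqP ->; congr (- _).
by apply: eq_Rintegral => x _; rewrite mulrC.
Qed.

Lemma Rintegral_itv_split a m b V : mu.-integrable `]a, b[ (EFin \o V) ->
    a <= m -> m <= b ->
  \int[mu]_(x in `]a, b[) V x =
  \int[mu]_(x in `]a, m[) V x + \int[mu]_(x in `]m, b[) V x.
Proof.
move=> iV am; rewrite le_eqVlt => /predU1P[->|mb].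
  by rewrite [X in _ + Rintegral _ X _]set_itv_ge ?bnd_simp// Rintegral_set0 addr0.
have := @Rintegral_itvB R V (BRight a) (BLeft b) m iV.
rewrite !bnd_simp => /(_ am mb) <-.
rewrite [\int[mu]_(x in `]a, m[) V x]Rintegral_itv_bndo_bndc.
  by rewrite [RHS]addrC subrK.
by apply: integrableS iV => //; apply: subset_itvl; rewrite bnd_simp ltW.
Qed.

Lemma Rintegral_ae_eq (D : set R) V W : measurable D ->
    measurable_fun D V -> measurable_fun D W -> ae_eq mu D V W ->
  \int[mu]_(x in D) V x = \int[mu]_(x in D) W x.
Proof.
move=> mD mV mW VW; congr fine; apply: ae_eq_integral => //.
- exact/measurable_EFinP.
- exact/measurable_EFinP.
- by apply: filterS VW => x VW Dx; rewrite /= VW.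
Qed.

Lemma Rintegral_sqr_eq0 (D : set R) V : measurable D ->
    mu.-integrable D (EFin \o (fun x => V x ^+ 2)) ->
    \int[mu]_(x in D) (V x ^+ 2) = 0 ->
  ae_eq mu D V (cst 0).
Proof.
move=> mD iV V0.
have mV2 := measurable_int _ iV.
have : (\int[mu]_(x in D) `|(EFin \o (fun x => V x ^+ 2)%R) x|)%E = 0%E.
  under eq_integral do rewrite gee0_abs ?lee_fin ?sqr_ge0//.
  rewrite -[LHS]fineK; last exact: integrable_fin_num iV.
  by rewrite -[fine _]/(\int[mu]_(x in D) (V x ^+ 2)) V0.
move=> V20; have := (ae_eq_integral_abs mu mD mV2).1 V20.
apply: filterS => x H Dx; have /= := H Dx.
by move=> [] /eqP; rewrite sqrf_eq0 => /eqP.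
Qed.

Lemma Rintegral_sqr_affine a b m : a < b ->
  \int[mu]_(x in `]a, b[) ((x - m) ^+ 2) = ((b - m) ^+ 3 - (a - m) ^+ 3) / 3.
Proof.
move=> ab; pose F := cst (3^-1) * (id - cst m) ^+ 3 : R -> R.
have dF (x : R) : is_derive x 1 F ((x - m) ^+ 2).
  apply: is_derive_eq; rewrite /GRing.scale/= !fctE expr2; lra.
have dFE : F^`()%classic = (fun x => (x - m) ^+ 2).
  by apply/funext => x; rewrite derive1E; case: (dF x).
have := Rintegral_derive1 a b F ab; rewrite dFE => ->.
- by rewrite /F !fctE; ring.
- by move=> x; case: (dF x).
- rewrite (_ : (fun x => _) = (id - cst m) * (id - cst m)); last first.
    by apply/funext => x; rewrite expr2.
  apply: elementary_continuous.
  have em : elementary (id - cst m).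
    by apply: elementaryD; [exact: elementary_id|apply/elementaryN/elementary_cst].
  exact: elementaryM.
Qed.

End weak_derivative.

(** * The obstacle problem *)

Section obstacle.
Context {R : realType}.
Notation mu := (@lebesgue_measure R).
Implicit Types (c f phi x : R) (g v : R -> R).

(** The primitive of [slope c], which is the function psi. For 0 <= c <= 1/2 it vanishes at 0 and 1,
    so [f * profile c] is the candidate w. Squared positive parts give two parabolic arcs and the
    plateau c^2/2 in one C^1 formula. *)
Definition profile c x : R :=
  (c ^+ 2 - Num.max 0 (c - x) ^+ 2 - Num.max 0 (x - (1 - c)) ^+ 2) / 2.

Definition slope c x : R := Num.max 0 (c - x) - Num.max 0 (x - (1 - c)).

Lemma max0_continuous : continuous (fun x : R => Num.max 0 x).
Proof.
move=> x; apply: (@continuous_max _ _ (cst 0) id).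
  exact: cvg_cst.
exact: cvg_id.
Qed.

Lemma is_derive_sqr_max0 (x : R) :
  is_derive x 1 (fun y : R => Num.max 0 y ^+ 2) (2 * Num.max 0 x).
Proof.
have [x0|x0|->] := ltgtP x 0.
- apply: (near_eq_is_derive (f := cst (0 : R))).
    near=> z; rewrite max_l ?expr0n//=.
    by near: z; exact: lt_le_nbhsl.
  by apply: is_derive_eq; rewrite mulr0.
- apply: (near_eq_is_derive (f := (id ^+ 2 : R -> R))).
    near=> z; rewrite max_r//.
    by near: z; exact: lt_le_nbhsr.
  by apply: is_derive_eq; rewrite /GRing.scale/= expr1 mulr1.
(* At 0 the square of the positive part of z is that positive part times z. *)
- apply/is_derive1_caratheodory; exists (fun y : R => Num.max 0 y); split.
  + move=> z; rewrite maxxx expr0n/= !subr0.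
    have [z0|z0] := leP z 0; first by rewrite expr0n/= mul0r.
    by rewrite expr2.
  + exact: max0_continuous.
  + by rewrite maxxx mulr0.
Unshelve. all: by end_near. Qed.

Lemma is_derive_profile c (x : R) : is_derive x 1 (profile c) (slope c x).
Proof.
have d1 := is_derive1_comp (is_derive_sqr_max0 _) (is_derive_affine (-1) c x).
have d2 := is_derive1_comp (is_derive_sqr_max0 _) (is_derive_affine 1 (- (1 - c)) x).
have d := is_deriveM (is_deriveB (is_deriveB (is_derive_cst (c ^+ 2) x 1) d1) d2)
  (is_derive_cst (2^-1 : R) x 1).
have -> : profile c = (cst (c ^+ 2) -
    ((fun y => Num.max 0 y ^+ 2) \o (fun y => -1 * y + c)) -
    ((fun y => Num.max 0 y ^+ 2) \o (fun y => 1 * y + - (1 - c)))) * cst 2^-1.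
  apply/funext => y; rewrite /profile !fctE; congr ((_ - Num.max _ _ ^+ 2 - Num.max _ _ ^+ 2) * _).
    by ring.
  by ring.
apply: (is_derive_eq d).
rewrite /GRing.scale /= /slope !mulN1r !mul1r [- x + c]addrC.
by field.
Qed.

Lemma slope_continuous c : continuous (slope c).
Proof.
move=> x; apply: (@cvgB _ R^o).
  apply: (@continuous_comp _ _ _ (fun y => c - y) (fun y => Num.max 0 y)).
    by apply: (@cvgB _ R^o); [exact: cvg_cst|exact: cvg_id].
  exact: max0_continuous.
apply: (@continuous_comp _ _ _ (fun y => y - (1 - c)) (fun y => Num.max 0 y)).
  by apply: (@cvgB _ R^o); [exact: cvg_id|exact: cvg_cst].
exact: max0_continuous.
Qed.

Lemma profile_continuous c : continuous (profile c).
Proof.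
move=> x; apply/differentiable_continuous/derivable1_diffP.
by case: (is_derive_profile c x).
Qed.

(** Multiplied by f < 0, this bounds the candidate from below, which gives its admissibility. *)
Lemma profile_le c x : profile c x <= c ^+ 2 / 2.
Proof.
rewrite /profile; have := sqr_ge0 (Num.max 0 (c - x)).
have := sqr_ge0 (Num.max 0 (x - (1 - c))); lra.
Qed.

Lemma profile_left c x : 0 <= c -> c <= 1 / 2 -> 0 <= x <= c ->
  profile c x = c * x - x ^+ 2 / 2.
Proof.
move=> c0 c1 /andP[x0 xc]; rewrite /profile max_r ?subr_ge0//.
rewrite max_l; last by lra.
by field.
Qed.

Lemma profile_mid c x : c <= x <= 1 - c -> profile c x = c ^+ 2 / 2.
Proof.
move=> /andP[x0 xc]; rewrite /profile max_l ?subr_le0// max_l ?subr_le0//.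
by field.
Qed.

Lemma profile_right c x : 0 <= c -> c <= 1 / 2 -> 1 - c <= x <= 1 ->
  profile c x = c * (1 - x) - (1 - x) ^+ 2 / 2.
Proof.
move=> c0 c1 /andP[x0 xc]; rewrite /profile max_l; last by lra.
rewrite max_r ?subr_ge0//.
by field.
Qed.

(** * Integrals against the slope and the decomposition of the energy *)

Lemma Rintegral_itv_split3 c v : 0 <= c -> c <= 1 / 2 ->
    mu.-integrable `]0, 1[ (EFin \o v) ->
  \int[mu]_(x in `]0, 1[) v x = \int[mu]_(x in `]0, c[) v x +
    (\int[mu]_(x in `]c, 1 - c[) v x + \int[mu]_(x in `](1 - c), 1[) v x).
Proof.
move=> c0 c1 iv; rewrite (Rintegral_itv_split _ c)//; last by lra.
congr (_ + _); apply: Rintegral_itv_split; [|lra..].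
by apply: integrableS iv => //; apply: subset_itvr; rewrite bnd_simp.
Qed.

Lemma Rintegral_sqr_slope c : 0 < c -> c <= 1 / 2 ->
  \int[mu]_(x in `]0, 1[) (slope c x ^+ 2) = 2 * c ^+ 3 / 3.
Proof.
move=> c0 c1; rewrite (Rintegral_itv_split3 c _ (ltW c0) c1); last first.
  apply: L2_sqr_integrable => //; apply: L2_within_continuous.
  by apply: continuous_subspaceT; exact: slope_continuous.
rewrite (_ : \int[mu]_(x in `]0, c[) _ = \int[mu]_(x in `]0, c[) ((x - c) ^+ 2)); last first.
  apply: eq_Rintegral => x; rewrite inE/= in_itv/= => /andP[x0 xc].
  rewrite /slope max_r; last by lra.
  by rewrite max_l ?subr0; [ring|lra].
rewrite (_ : \int[mu]_(x in `]c, _[) _ = \int[mu]_(x in `]c, 1 - c[) 0); last first.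
  apply: eq_Rintegral => x; rewrite inE/= in_itv/= => /andP[x0 xc].
  by rewrite /slope !max_l ?subr0 ?expr0n//; lra.
rewrite (_ : \int[mu]_(x in `]_, 1[) _ = \int[mu]_(x in `](1 - c), 1[) ((x - (1 - c)) ^+ 2)); last first.
  apply: eq_Rintegral => x; rewrite inE/= in_itv/= => /andP[x0 xc].
  rewrite /slope max_l; last by lra.
  by rewrite max_r ?sub0r ?sqrrN//; lra.
rewrite !Rintegral_sqr_affine//; last by lra.
by rewrite Rintegral_cst// mul0r; field.
Qed.

(** On both outer intervals psi is affine with derivative -1, so integrating by parts returns the
    integral of [v]. No boundary term survives: [v] vanishes at 0 and 1, psi at c and 1 - c. *)
Lemma Rintegral_mul_slope c v g : 0 < c -> c <= 1 / 2 ->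
    {within `[0, 1], continuous v} -> v 0 = 0 -> v 1 = 0 ->
    weak_derivative `]0, 1[ v g ->
  \int[mu]_(x in `]0, 1[) (g x * slope c x) =
  \int[mu]_(x in `]0, 1[) v x - \int[mu]_(x in `]c, 1 - c[) v x.
Proof.
move=> c0 c1 cv v0 v1 wg.
(* The slope equals d - x with d = c on the left interval and d = 1 - c on the right one. *)
have ecid (d : R) : elementary (cst d - id).
  by apply: elementaryD; [exact: elementary_cst|exact/elementaryN/elementary_id].
have decid (d : R) : (cst d - id)^`()%classic = (cst (-1) : R -> R).
  by apply/funext => x; rewrite derive1E; apply: derive_val; apply: is_derive_eq; rewrite sub0r.
have iv : mu.-integrable `]0, 1[ (EFin \o v) by exact: within_continuous_integrable_oo.
have ig : mu.-integrable `]0, 1[ (EFin \o (fun x => g x * slope c x)).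
  apply: L2_mul_integrable => //; first exact: wg.1.
  by apply: L2_within_continuous; apply: continuous_subspaceT; exact: slope_continuous.
rewrite (Rintegral_itv_split3 c _ (ltW c0) c1 ig) (Rintegral_itv_split3 c _ (ltW c0) c1 iv).
have -> : \int[mu]_(x in `]0, c[) (g x * slope c x) = \int[mu]_(x in `]0, c[) v x.
  transitivity (\int[mu]_(x in `]0, c[) (g x * (cst c - id) x)).
    apply: eq_Rintegral => x; rewrite inE/= in_itv/= => /andP[x0 xc].
    rewrite /slope max_r; last by lra.
    by rewrite max_l ?subr0//; lra.
  rewrite (weak_derivative_by_parts _ _ _ _ _ _ _ cv wg (ecid c))//; last by lra.
  rewrite decid RintegralZr//; last first.
    by apply: integrableS iv => //; apply: subset_itvl; rewrite bnd_simp; lra.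
  by rewrite !fctE v0; ring.
have -> : \int[mu]_(x in `](1 - c), 1[) (g x * slope c x) = \int[mu]_(x in `](1 - c), 1[) v x.
  transitivity (\int[mu]_(x in `](1 - c), 1[) (g x * (cst (1 - c) - id) x)).
    apply: eq_Rintegral => x; rewrite inE/= in_itv/= => /andP[x0 xc].
    rewrite /slope max_l; last by lra.
    by rewrite max_r ?sub0r ?opprB//; lra.
  rewrite (weak_derivative_by_parts _ _ _ _ _ _ _ cv wg (ecid _))//; [|lra..].
  rewrite decid RintegralZr//; last first.
    by apply: integrableS iv => //; apply: subset_itvr; rewrite bnd_simp; lra.
  by rewrite !fctE v1; ring.
have -> : \int[mu]_(x in `]c, 1 - c[) (g x * slope c x) = 0.
  rewrite (_ : Rintegral _ _ _ = \int[mu]_(x in `]c, 1 - c[) 0).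
    by rewrite Rintegral_cst// mul0r.
  apply: eq_Rintegral => x; rewrite inE/= in_itv/= => /andP[x0 xc].
  by rewrite /slope !max_l ?subr0 ?mulr0//; lra.
by ring.
Qed.

Lemma wderiv_weak_derivative v : H10 v ->
  weak_derivative `]0, 1[ v (wderiv `]0, 1[ v).
Proof. by move=> [[_ [g wg]] _ _ _]; apply: xgetPex; exists g. Qed.

(** Completing the square in v' produces the cross term f times the integral of v' psi. Its
    conversion into integrals of [v] cancels the load term outside the contact interval. *)
Lemma energyE f c v : 0 < c -> c <= 1 / 2 -> H10 v ->
  energy f v =
    1 / 2 * (\int[mu]_(x in `]0, 1[) ((wderiv `]0, 1[ v x - f * slope c x) ^+ 2))
    - f ^+ 2 * c ^+ 3 / 3 - f * \int[mu]_(x in `]c, 1 - c[) v x.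
Proof.
move=> c0 c1 Hv; have wg := wderiv_weak_derivative _ Hv.
have [_ cv v0 v1] := Hv.
rewrite /energy; set g := wderiv _ _ in wg *.
have iv : mu.-integrable `]0, 1[ (EFin \o v) by exact: within_continuous_integrable_oo.
have L2s : L2 `]0, 1[ (slope c).
  by apply: L2_within_continuous; apply: continuous_subspaceT; exact: slope_continuous.
have igs : mu.-integrable `]0, 1[ (EFin \o (fun x => g x * slope c x)).
  by apply: L2_mul_integrable => //; exact: wg.1.
have ig2 : mu.-integrable `]0, 1[ (EFin \o (fun x => g x ^+ 2)).
  by apply: L2_sqr_integrable => //; exact: wg.1.
have is2 : mu.-integrable `]0, 1[ (EFin \o (fun x => slope c x ^+ 2)).
  exact: L2_sqr_integrable.
have igs2 : mu.-integrable `]0, 1[ (EFin \o (fun x => 2 * f * (g x * slope c x))).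
  exact: (eq_integrable _ _ _ _ (integrableZl _ (2 * f) igs)).
have is22 : mu.-integrable `]0, 1[ (EFin \o (fun x => f ^+ 2 * slope c x ^+ 2)).
  exact: (eq_integrable _ _ _ _ (integrableZl _ (f ^+ 2) is2)).
have iB : mu.-integrable `]0, 1[ (EFin \o (fun x => g x ^+ 2 - 2 * f * (g x * slope c x))).
  exact: (eq_integrable _ _ _ _ (integrableB _ ig2 igs2)).
have -> : \int[mu]_(x in `]0, 1[) ((g x - f * slope c x) ^+ 2) =
    \int[mu]_(x in `]0, 1[) (g x ^+ 2)
    - 2 * f * (\int[mu]_(x in `]0, 1[) (g x * slope c x))
    + f ^+ 2 * \int[mu]_(x in `]0, 1[) (slope c x ^+ 2).
  rewrite -!RintegralZl// -RintegralB// -RintegralD//.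
  by apply: eq_Rintegral => x _; ring.
rewrite (Rintegral_mul_slope c v g)// Rintegral_sqr_slope// RintegralZl//.
by field.
Qed.

Lemma H10_profile f c : 0 < c -> c <= 1 / 2 ->
  H10 (fun x => f * profile c x) /\
  weak_derivative `]0, 1[ (fun x => f * profile c x) (fun x => f * slope c x).
Proof.
move=> c0 c1.
have cw : {within `[0, 1], continuous (fun x => f * profile c x)}.
  by apply: within_continuousM; [move=> x; exact: cvg_cst|
    apply: continuous_subspaceT; exact: profile_continuous].
have wg : weak_derivative `]0, 1[ (fun x => f * profile c x) (fun x => f * slope c x).
  apply: C1_weak_derivative; first exact: ltr01.
    move=> x; have := is_deriveM (is_derive_cst f x 1) (is_derive_profile c x).
    by move=> /is_derive_eq; apply; rewrite /GRing.scale/= mulr0 addr0.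
  move=> x; apply: (@cvgM _ R^o); [exact: cvg_cst|exact: slope_continuous].
split => //; split => //.
- split; last by exists (fun x => f * slope c x).
  exact: L2_within_continuous.
- by rewrite profile_left ?(ltW c0) ?lexx//; ring.
- by rewrite profile_right ?(ltW c0) ?lexx ?andbT//; [ring|lra].
Qed.

Lemma Rintegral_ae_ge0 (D : set R) v : measurable D -> measurable_fun D v ->
    {ae mu, forall x, D x -> 0 <= v x} ->
  0 <= \int[mu]_(x in D) v x.
Proof.
move=> mD mv v0; rewrite (Rintegral_ae_eq D v (fun x => `|v x|))//.
- by apply: Rintegral_ge0 => x _.
- exact: measurableT_comp.
- move: v0; apply: filterS; first exact: (ae_filter_ringOfSetsType mu).
  by move=> x v0 Dx; rewrite ger0_norm// v0.
Qed.

Lemma Rintegral_cst_itv_oo (a b k : R) : a <= b ->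
  \int[mu]_(x in `]a, b[) k = k * (b - a).
Proof.
move=> ab; rewrite Rintegral_cst//.
congr (_ * _); rewrite -[RHS]/(fine (b - a)%:E); congr fine; rewrite [LHS](@lebesgue_measure_itv R).
rewrite /= lte_fin -EFinD; case: ltP => // ba.
by have -> : a = b; [lra|rewrite subrr].
Qed.

(** In the decomposed energy the square vanishes, since the chosen weak derivative agrees a.e. with
    [f * slope c], and the candidate is constant on the contact interval. *)
Lemma energy_profile f c : 0 < c -> c <= 1 / 2 ->
  energy f (fun x => f * profile c x) =
  - (f ^+ 2 * c ^+ 3 / 3) - f * (f * c ^+ 2 / 2 * (1 - 2 * c)).
Proof.
move=> c0 c1; have [H10w wg] := H10_profile f c c0 c1.
rewrite (energyE f c _ c0 c1 H10w).
have cs : {within `[0, 1], continuous (fun x => f * slope c x)}.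
  apply: within_continuousM; first by move=> x; exact: cvg_cst.
  by apply: continuous_subspaceT; exact: slope_continuous.
set g := wderiv _ _; have wg' := wderiv_weak_derivative _ H10w : weak_derivative _ _ g.
have [_ cw _ _] := H10w.
have gs := weak_derivative_ae_unique _ _ _ _ _ cw wg' wg.
have -> : \int[mu]_(x in `]0, 1[) ((g x - f * slope c x) ^+ 2) = 0.
  rewrite (Rintegral_ae_eq _ _ (cst 0))//.
  - by rewrite Rintegral_cst// mul0r.
  - have mg : measurable_fun `](0 : R), 1[ g by apply: L2_measurable => //; exact: wg'.1.
    apply: measurable_funX; apply: measurable_funB => //.
    by apply: L2_measurable => //; exact: L2_within_continuous.
  - by apply: filterS gs => x gs x01; rewrite gs// subrr expr0n.
have -> : \int[mu]_(x in `]c, 1 - c[) (f * profile c x) = f * c ^+ 2 / 2 * (1 - 2 * c).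
  transitivity (\int[mu]_(x in `]c, 1 - c[) (f * c ^+ 2 / 2)).
    apply: eq_Rintegral => x; rewrite inE/= in_itv/= => /andP[cx x1].
    by rewrite profile_mid ?mulrA// !ltW.
  by rewrite Rintegral_cst_itv_oo; [ring|lra].
by field.
Qed.

(** The inequality on [phi] makes the candidate admissible, its plateau being at height f c^2/2. The
    disjunction says that the contact interval is empty or that the plateau touches the obstacle;
    either way no admissible function has a smaller integral there. *)
Lemma obstacle_solution_profile f phi c u : f < 0 -> 0 < c -> c <= 1 / 2 ->
    phi <= f * c ^+ 2 / 2 -> (c = 1 / 2 \/ phi = f * c ^+ 2 / 2) ->
    obstacle_solution f phi u ->
  (forall x, x \in `[0, 1] -> u x = f * profile c x) /\
  energy f u = - (f ^+ 2 * c ^+ 3 / 3) - f * (f * c ^+ 2 / 2 * (1 - 2 * c)).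
Proof.
move=> f0 c0 c1 phic cphi [[H10u u_ge] u_min].
have [H10w ww] := H10_profile f c c0 c1.
have [_ cu u0 u1] := H10u.
have [_ cw w0 w1] := H10w.
have wg := wderiv_weak_derivative _ H10u.
have E1 := energyE f c u c0 c1 H10u.
set g := wderiv _ _ in wg E1.
have Ew := energy_profile f c c0 c1.
have le_uw : energy f u <= energy f (fun x => f * profile c x).
  rewrite -lee_fin u_min; apply: ereal_inf_lbound; exists (fun x => f * profile c x) => //.
  split=> //; apply: aeW => x _; apply: le_trans phic _.
  by rewrite -mulrA ler_wnM2l ?(ltW f0)// profile_le.
have mid_ge : f * c ^+ 2 / 2 * (1 - 2 * c) <= \int[mu]_(x in `]c, 1 - c[) u x.
  case: cphi => [->|<-].
    rewrite [X in _ <= Rintegral _ X _]set_itv_ge ?Rintegral_set0; last first.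
      by rewrite bnd_simp -leNgt; lra.
    lra.
  have iu : mu.-integrable `]c, 1 - c[ (EFin \o u).
    apply: integrableS (within_continuous_integrable_oo _ _ _ cu) => //.
    by apply: subset_itvSoo; rewrite bnd_simp; lra.
  have iphi : mu.-integrable `]c, 1 - c[ (EFin \o cst phi).
    by apply: within_continuous_integrable_oo => x; exact: cvg_cst.
  have cphiE : \int[mu]_(x in `]c, 1 - c[) (cst phi x) = phi * (1 - 2 * c).
    by rewrite Rintegral_cst_itv_oo; [ring|lra].
  rewrite -cphiE -subr_ge0 -RintegralB//; apply: Rintegral_ae_ge0 => //.
    apply: measurable_funB => //.
    by apply/measurable_EFinP; exact: measurable_int iu.
  move: u_ge; apply: filterS; first exact: (ae_filter_ringOfSetsType mu).
  move=> x + xc; rewrite subr_ge0; apply.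
  by move: xc; rewrite /= !in_itv/= => /andP[cx x1]; apply/andP; split; lra.
have Ls : L2 `]0, 1[ (fun x => f * slope c x) by exact: ww.1.
have igs : mu.-integrable `]0, 1[ (EFin \o (fun x => (g x - f * slope c x) ^+ 2)).
  have ig2 := L2_sqr_integrable _ _ (measurable_itv _) wg.1.
  have is2 := L2_sqr_integrable _ _ (measurable_itv _) Ls.
  have igs := L2_mul_integrable _ _ _ (measurable_itv _) wg.1 Ls.
  apply: (eq_integrable _ _ _ _ (integrableD _ (integrableB _ ig2 (integrableZl _ 2 igs)) is2)) => //.
  by move=> x _ /=; congr EFin; ring.
have sq_ge0 : 0 <= \int[mu]_(x in `]0, 1[) ((g x - f * slope c x) ^+ 2).
  by apply: Rintegral_ge0 => x _; exact: sqr_ge0.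
have fmid : - f * (f * c ^+ 2 / 2 * (1 - 2 * c)) <= - f * \int[mu]_(x in `]c, 1 - c[) u x.
  by rewrite ler_wpM2l// oppr_ge0 ltW.
(* The two energies share the constant term, so [le_uw] and [fmid] leave no room for a positive
   square. *)
have sq0 : \int[mu]_(x in `]0, 1[) ((g x - f * slope c x) ^+ 2) = 0.
  apply/eqP; rewrite eq_le sq_ge0 andbT.
  by move: le_uw fmid; rewrite E1 Ew; clear; lra.
split; last first.
  apply/eqP; rewrite -Ew eq_le le_uw/=.
  by move: fmid; rewrite E1 Ew sq0; clear; lra.
have gs := Rintegral_sqr_eq0 _ _ (measurable_itv _) igs sq0.
(* Both functions vanish at 0 and are recovered by integrating a.e. equal weak derivatives over ]0,
   x[. The point x = 0 is separate because that integration requires a nonempty interval. *)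
move=> x; rewrite in_itv/= le_eqVlt => /andP[/predU1P[<- _|x0 x1]].
  by rewrite u0 w0.
have := weak_derivative_Rintegral _ _ _ _ _ _ cu wg (lexx 0) x0 x1.
have := weak_derivative_Rintegral _ _ _ _ _ _ cw ww (lexx 0) x0 x1.
rewrite u0 w0 !subr0 => <- <-.
have sub : `]0, x[ `<=` `]0, 1[ by apply: subset_itvl; rewrite bnd_simp.
apply: Rintegral_ae_eq => //.
- by apply: measurable_funS sub _ => //; apply: L2_measurable => //; exact: wg.1.
- by apply: measurable_funS sub _ => //; exact: L2_measurable.
- apply: filterS gs => y gs /sub y01; have /eqP := gs y01.
  by rewrite subr_eq0 => /eqP.
Qed.

End obstacle.

Theorem mainTheorem1 (R : realType) (f phi : R) (f_lt0 : f < 0)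
    (phi_lt0 : phi < 0) (u : R -> R) (u_sol : obstacle_solution f phi u) :
  (`|f| < 8 * `|phi| ->
    (forall x, x \in `[0, 1] -> u x = f / 2 * (x - x ^+ 2)) /\
    energy f u = - (f ^+ 2 / 24))
  /\
  (`|f| >= 8 * `|phi| ->
    [/\ forall x, x \in `[0, Num.sqrt (2 * phi / f)[ ->
          u x = - (f / 2) * x ^+ 2 - Num.sqrt (2 * phi * f) * x,
        forall x, x \in `[Num.sqrt (2 * phi / f),
                          1 - Num.sqrt (2 * phi / f)] ->
          u x = phi,
        forall x, x \in `]1 - Num.sqrt (2 * phi / f), 1] ->
          u x = - (f / 2) * (x - 1) ^+ 2 + Num.sqrt (2 * phi * f) * (x - 1) &
        energy f u = f * phi * (4 / 3 * Num.sqrt (2 * phi / f) - 1)]).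
Proof.
rewrite !ltr0_norm//; split => [f_phi|phi_f].
  (* For c = 1/2 the lowest value of the candidate is f/8, which lies above [phi] by the assumption
     on |f|. *)
  have [] := obstacle_solution_profile f phi (1 / 2) u f_lt0 _ _ _ _ u_sol.
  - lra.
  - lra.
  - lra.
  - by left.
  move=> uE ->; split; last by field.
  move=> x x01; rewrite uE//; move: x01; rewrite in_itv/= => /andP[x0 x1].
  have [xh|hx] := leP x (1 / 2).
    by rewrite profile_left ?x0//; [field|lra..].
  by rewrite profile_right ?x1 ?andbT//; [field|lra..].
(* This c places the plateau f c^2/2 exactly at height [phi]; the condition |f| >= 8 |phi| then
   amounts to c <= 1/2. *)
set c := Num.sqrt (2 * phi / f).
have q_gt0 : 0 < 2 * phi / f by rewrite -mulrNN -invrN divr_gt0//; lra.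
have c0 : 0 < c by rewrite sqrtr_gt0.
have c2 : c ^+ 2 = 2 * phi / f by rewrite sqr_sqrtr// ltW.
have fc2 : f * c ^+ 2 / 2 = phi by rewrite c2; field; rewrite lt_eqF.
have c1 : c <= 1 / 2.
  have c2_le : c ^+ 2 <= 1 / 4 by rewrite c2 ler_ndivrMr//; lra.
  by rewrite leNgt; apply/negP => c_gt; nra.
(* The product 2 phi f is (f c)^2, and its root is - f c because f < 0. *)
have sE : Num.sqrt (2 * phi * f) = - f * c.
  have -> : 2 * phi * f = (- f * c) ^+ 2 by rewrite -fc2; field.
  by rewrite sqrtr_sqr gtr0_norm// mulr_gt0// oppr_gt0.
have [uE ->] := obstacle_solution_profile f phi c u f_lt0 c0 c1
  (eq_ind_r (fun z => phi <= z) (lexx _) fc2) (or_intror (esym fc2)) u_sol.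
rewrite sE; split.
- move=> x; rewrite in_itv/= => /andP[x0 xc].
  rewrite uE ?in_itv/= ?x0/=; last by lra.
  by rewrite profile_left ?x0 ?(ltW xc) ?(ltW c0)//; field.
- move=> x; rewrite in_itv/= => /andP[cx xc].
  rewrite uE ?in_itv/=; last by apply/andP; split; lra.
  by rewrite profile_mid ?cx// mulrA.
- move=> x; rewrite in_itv/= => /andP[cx x1].
  rewrite uE ?in_itv/= ?x1 ?andbT; last by lra.
  by rewrite profile_right ?x1 ?andbT ?(ltW cx) ?(ltW c0)//; field.
- by rewrite -fc2; field.
Qed.
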